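(* Consider a Controlled Dynamical Multi-Commodity Flow Network (C-DMFN) on a directed multigraph $\mathcal{G}=(\mathcal{V},\mathcal{E})$ with commodity set $\mathcal{K}$, and let $x^0\in\mathbb{R}_+^{\mathcal{E}\times\mathcal{K}}$ be initial traffic volumes. Let $(\bar x(t),\bar z(t),\bar f(t))$, $t\in[0,T]$, be any feasible solution of the relaxed problem (Problem 2) with $\bar x(0)=x^0$. For all $i\in\mathcal{E}$, $k\in\mathcal{K}$, set $$\alpha_i^{(k)}(t)=\frac{\bar z_i^{(k)}(t)}{d_i^{(k)}(\bar x_i^{(k)}(t))},$$ with the convention that $\alpha_i^{(k)}(t)=1$ if $\bar z_i^{(k)}(t)=d_i^{(k)}(\bar x_i^{(k)}(t))=0$. Then, with these control parameters, $(x,z,f)=(\bar x,\bar z,\bar f)$ satisfies the C-DMFN equations (E1)--(E4), and $\alpha=(\alpha_i^{(k)})$ is a (feasible) solution of the original freeway network control problem (Problem 1).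
   Context: **Network.** $\mathcal{G}=(\mathcal{V},\mathcal{E})$ is a nonempty finite directed multigraph; its links are called cells. Cell $i$ is directed from its tail node $\tau_i$ to its head node $\sigma_i$. $\mathcal{R},\mathcal{S}\subset\mathcal{E}$ are the sets of onramps and offramps, with $\mathcal{R}\cap\mathcal{S}=\emptyset$. $\mathcal{A}=\{(i,j)\in\mathcal{E}\times\mathcal{E}:\sigma_i=\tau_j\}$ is the set of adjacent (consecutive) cell pairs. $\mathcal{K}$ is a finite set of commodities. The state is $x=(x_i^{(k)})\in\mathbb{R}_+^{\mathcal{E}\times\mathcal{K}}$, where $x_i^{(k)}$ is the traffic volume of commodity $k$ in cell $i$. **Demand and supply.** For all $i\in\mathcal{E}$, $k\in\mathcal{K}$, the demand function $d_i^{(k)}:\mathbb{R}_+\to\mathbb{R}_+$ is Lipschitz-continuous, concave, non-decreasing, with $d_i^{(k)}(0)=0$. For all $i\in\mathcal{E}$, the supply function $s_i:\mathbb{R}_+\to\mathbb{R}_+$ is Lipschitz-continuous, concave and non-increasing; it is evaluated at $\sum_{k\in\mathcal{K}}w_i^{(k)}x_i^{(k)}$, where $w_i^{(k)}>0$ are given weights. **Inflows and routing.** The exogenous inflows satisfy $\lambda_i^{(k)}(t)\ge0$, with $\lambda_i^{(k)}\equiv0$ for $i\in\mathcal{E}\setminus\mathcal{R}$. The routing matrices $R^{(k)}(t)\in\mathbb{R}_+^{\mathcal{E}\times\mathcal{E}}$ have entries in $[0,1]$ and satisfy, for all $t\geq 0$ and $k\in\mathcal{K}$: $\sum_{j\in\mathcal{E}}R_{ij}^{(k)}(t)=1$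 if $i\in\mathcal{E}\setminus\mathcal{S}$ and $=0$ if $i\in\mathcal{S}$; and $R_{ij}^{(k)}(t)=0$ whenever $(i,j)\notin\mathcal{A}$. **C-DMFN.** Given control parameters $\alpha_i^{(k)}(t)\in[0,1]$, the C-DMFN is the dynamical system defined, for all $i,j\in\mathcal{E}$, $k\in\mathcal{K}$, by (E1) $\dot x_i^{(k)}(t)=\lambda_i^{(k)}(t)+\sum_{j\in\mathcal{E}}f_{ji}^{(k)}-z_i^{(k)}$; (E2) $z_i^{(k)}=\sum_{j\in\mathcal{E}}f_{ij}^{(k)}$ if $i\in\mathcal{E}\setminus\mathcal{S}$, and $z_i^{(k)}=\alpha_i^{(k)}d_i^{(k)}(x_i^{(k)})$ if $i\in\mathcal{S}$; (E3) $f_{ij}^{(k)}=\gamma_i^F\,R_{ij}^{(k)}(t)\,\alpha_i^{(k)}(t)\,d_i^{(k)}(x_i^{(k)})$; (E4) $\gamma_i^F$ is the largest $\gamma\in[0,1]$ such that, for every $j\in\mathcal{E}$ with $R_{ij}^{(k)}(t)>0$ for some $k\in\mathcal{K}$, $$\gamma\sum_{k\in\mathcal{K}}\sum_{h\in\mathcal{E}}R_{hj}^{(k)}(t)\alpha_h^{(k)}(t)d_h^{(k)}(x_h^{(k)})\le s_j\Big(\sum_{k\in\mathcal{K}}w_j^{(k)}x_j^{(k)}\Big).$$ **Cost.** $\varphi(x,z)$ is convex and differentiable in $(x,z)$, non-decreasing in $x$ ($\partial\varphi/\partial x\ge0$), non-increasing in $z$ ($\partial\varphi/\partial z\le0$),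 and $\varphi(0,0)=0$. $T>0$ is a finite horizon. **Problem 1 (original problem).** Minimize $\int_0^T\varphi(x(t),z(t))\,dt$ over control parameters $\alpha_i^{(k)}(t)\in[0,1]$, $i\in\mathcal{E}$, $k\in\mathcal{K}$, $t\in[0,T]$, subject to (E1)--(E4) and $x(0)=x^0$. **Problem 2 (relaxation).** Minimize $\int_0^T\varphi(\bar x(t),\bar z(t))\,dt$ over non-negative time-dependent variables $\bar x(t)\in\mathbb{R}_+^{\mathcal{E}\times\mathcal{K}}$, $\bar z(t)\in\mathbb{R}_+^{\mathcal{E}\times\mathcal{K}}$, $\bar f(t)\in\mathbb{R}_+^{\mathcal{A}\times\mathcal{K}}$ (with $\bar f_{ij}^{(k)}:=0$ for $(i,j)\notin\mathcal{A}$), subject to, for all $t\in[0,T]$, $i\in\mathcal{E}$, $k\in\mathcal{K}$: - $\dot{\bar x}_i^{(k)}(t)=\lambda_i^{(k)}(t)+\sum_{j\in\mathcal{E}}\bar f_{ji}^{(k)}(t)-\bar z_i^{(k)}(t)$; - $\bar z_i^{(k)}(t)\le d_i^{(k)}(\bar x_i^{(k)}(t))$; - $\sum_{k\in\mathcal{K}}\sum_{j\in\mathcal{E}}\bar f_{ji}^{(k)}(t)\le s_i\big(\sum_{k\in\mathcal{K}}w_i^{(k)}\bar x_i^{(k)}(t)\big)$; - $\bar f_{ij}^{(k)}(t)=R_{ij}^{(k)}(t)\bar z_i^{(k)}(t)$ for all $(i,j)\in\mathcal{A}$; - $\bar x(0)=x^0$. A feasible solution is one satisfying all constraints of the respective problem.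 *)

(* Defs.v *)
From HB Require Import structures.
From mathcomp Require Import all_boot all_order all_algebra.
From mathcomp Require Import all_classical all_reals all_analysis.
Export numFieldNormedType.Exports.

Set Implicit Arguments.
Unset Strict Implicit.
Unset Printing Implicit Defensive.

Import Order.TTheory GRing.Theory Num.Theory.

Local Open Scope classical_set_scope.
Local Open Scope ring_scope.

(* Cells are the links; [tail] and [head] need not be jointly injective, so
   parallel cells (and self-loops) are allowed. *)
Record network := Network {
  node : finType;
  cell : finType;
  tail : cell -> node;
  head : cell -> node;
  onramps : {set cell};
  offramps : {set cell};
  node_nonempty : (0 < #|node|)%N;
  ramps_disjoint : (onramps :&: offramps = finset.set0)%SET }.

Definition adjacent_cells (G : network) (i j : cell G) : bool := head i == tail j.

Section FunctionClasses.
Variable R : realType.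

(* Functions on the half-line of nonnegative reals are total functions
   constrained (and used) on [0, +oo[ only. *)
Let Rplus : set R := `[0, +oo[.

Definition lipschitz_nneg (f : R -> R) : Prop :=
  exists L : R, L.-lipschitz_(Rplus) f.

Definition concave_nneg (f : R -> R) : Prop :=
  @convex_function R R^o Rplus (fun x => - f x).

Record demand_function (d : R -> R) : Prop := DemandFunction {
  demand_ge0 : forall x, 0 <= x -> 0 <= d x;
  demand_lipschitz : lipschitz_nneg d;
  demand_concave : concave_nneg d;
  demand_ndecr : forall x y, 0 <= x -> x <= y -> d x <= d y;
  demand0 : d 0 = 0 }.

Record supply_function (s : R -> R) : Prop := SupplyFunction {
  supply_ge0 : forall x, 0 <= x -> 0 <= s x;
  supply_lipschitz : lipschitz_nneg s;
  supply_concave : concave_nneg s;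
  supply_nincr : forall x y, 0 <= x -> x <= y -> s y <= s x }.

End FunctionClasses.

(* [routing t k i j] is the (i, j) entry of the routing matrix of commodity [k]
   at time [t]; time-dependent data are constrained at times [t >= 0] only. *)
Record cdmfn (R : realType) (G : network) (K : finType) := Cdmfn {
  demand : cell G -> K -> R -> R;
  supply : cell G -> R -> R;
  weight : cell G -> K -> R;
  inflow : R -> cell G -> K -> R;
  routing : R -> K -> cell G -> cell G -> R;
  demandP : forall i k, demand_function (demand i k);
  supplyP : forall i, supply_function (supply i);
  weight_gt0 : forall i k, 0 < weight i k;
  inflow_ge0 : forall t i k, 0 <= t -> 0 <= inflow t i k;
  inflow_eq0 : forall t i k, 0 <= t -> i \notin onramps G -> inflow t i k = 0;
  routing_itv : forall t k i j, 0 <= t -> 0 <= routing t k i j <= 1;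
  routing_sum : forall t k i, 0 <= t ->
    \sum_j routing t k i j = if i \in offramps G then 0 else 1;
  routing_adj : forall t k i j, 0 <= t ->
    ~~ adjacent_cells i j -> routing t k i j = 0 }.

Section Dynamics.
Variables (R : realType) (G : network) (K : finType) (N : cdmfn R G K).

Local Notation E := (cell G).

Definition state := E -> K -> R.
Definition flow := E -> E -> K -> R.

Definition nonneg_state (x : state) : Prop := forall i k, 0 <= x i k.

(* [v] is the derivative at [t] of [u] seen as a function on [0, T]; it is
   one-sided at the two endpoints. *)
Definition has_derivative_within (T : R) (u : R -> R) (t v : R) : Prop :=
  (s - t)^-1 * (u s - u t) @[s --> within `[0, T] t^'] --> v.

Definition supply_at (x : state) (j : E) : R :=
  supply N j (\sum_k weight N j k * x j k).

Definition fifo_admissible (t : R) (a x : state) (i : E) : set R :=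
  [set g | 0 <= g <= 1 /\
    forall j, (exists k, 0 < routing N t k i j) ->
      g * (\sum_k \sum_h routing N t k h j * a h k * demand N h k (x h k))
        <= supply_at x j].

Definition is_largest (A : set R) (g : R) : Prop := A g /\ ubound A g.

(* The controlled dynamics on the time interval [0, T]. *)
Definition cdmfn_equations (T : R) (alpha x z : R -> state) (f : R -> flow) :
    Prop :=
  exists gammaF : R -> E -> R, forall t, 0 <= t <= T ->
  [/\ nonneg_state (x t),
      forall i k, has_derivative_within T (fun s => x s i k) t
        (inflow N t i k + \sum_j f t j i k - z t i k),
      forall i k, z t i k =
        if i \in offramps G then alpha t i k * demand N i k (x t i k)
        else \sum_j f t i j k,
      forall i j k, f t i j k =
        gammaF t i * routing N t k i j * alpha t i k * demand N i k (x t i k)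
    & forall i, is_largest (fifo_admissible t (alpha t) (x t) i) (gammaF t i)].

Record min_problem (V : Type) := MinProblem {
  feasible : set V;
  objective : V -> \bar R }.

Definition state_mx (x : state) : 'M[R]_(#|E|, #|K|) :=
  \matrix_(i, k) x (enum_val i) (enum_val k).

Local Notation XZ := ('M[R]_(#|E|, #|K|) * 'M[R]_(#|E|, #|K|))%type.

Definition cost := XZ -> R.

Definition nonneg_orthant : set XZ :=
  [set p : XZ | forall i k, 0 <= p.1 i k /\ 0 <= p.2 i k].

(* A cost is a function on the nonnegative orthant, represented by a total
   function. Differentiability at the boundary is no restriction: a function
   with one-sided differentials there extends across each face by odd
   reflection about its boundary values. *)
Record cost_function (phi : cost) : Prop := CostFunction {
  cost_convex : convex_function nonneg_orthant phi;
  cost_differentiable : forall p, nonneg_orthant p -> differentiable phi p;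
  cost_ndecr_x : forall p, nonneg_orthant p ->
    forall i k, 0 <= 'D_(delta_mx i k, 0) phi p;
  cost_nincr_z : forall p, nonneg_orthant p ->
    forall i k, 'D_(0, delta_mx i k) phi p <= 0;
  cost0 : phi (0, 0) = 0 }.

Definition total_cost (phi : cost) (T : R) (x z : R -> state) : \bar R :=
  (\int[lebesgue_measure]_(t in `[0%R, T])
    (phi (state_mx (x t), state_mx (z t)))%:E)%E.

(* The decision variable is the control [alpha]; the trajectory [(x, z, f)] it
   is required to produce is carried along in the points of the problem. *)
Definition original_problem (phi : cost) (T : R) (x0 : state) :
    min_problem ((R -> state) * (R -> state) * (R -> state) * (R -> flow)) :=
  MinProblem
    [set p | let: (alpha, x, z, f) := p in
      [/\ forall t i k, 0 <= t <= T -> 0 <= alpha t i k <= 1,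
          cdmfn_equations T alpha x z f
        & forall i k, x 0 i k = x0 i k]]
    (fun p => let: (alpha, x, z, f) := p in total_cost phi T x z).

(* The entries [f i j k] with [(i, j)] not adjacent are not variables: they are
   fixed to [0]. *)
Definition relaxed_problem (phi : cost) (T : R) (x0 : state) :
    min_problem ((R -> state) * (R -> state) * (R -> flow)) :=
  MinProblem
    [set p | let: (x, z, f) := p in
      [/\ forall t, 0 <= t <= T ->
            [/\ nonneg_state (x t), nonneg_state (z t),
                forall i j k, 0 <= f t i j k
              & forall i j k, ~~ adjacent_cells i j -> f t i j k = 0],
          forall t, 0 <= t <= T -> forall i k,
            [/\ has_derivative_within T (fun s => x s i k) t
                  (inflow N t i k + \sum_j f t j i k - z t i k),
                z t i k <= demand N i k (x t i k),
                \sum_k' \sum_j f t j i k' <= supply_at (x t) i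
              & forall j, adjacent_cells i j -> f t i j k = routing N t k i j * z t i k]
        & forall i k, x 0 i k = x0 i k]]
    (fun p => let: (x, z, f) := p in total_cost phi T x z).

Definition induced_control (x z : R -> state) : R -> state := fun t i k =>
  let d := demand N i k (x t i k) in
  if (z t i k == 0) && (d == 0) then 1 else z t i k / d.

End Dynamics.

(* Main.v *)
Require Import Defs.
From mathcomp Require Import all_boot all_order all_algebra.
From mathcomp Require Import all_classical all_reals all_analysis.

Set Implicit Arguments.
Unset Strict Implicit.
Unset Printing Implicit Defensive.

Import Order.TTheory GRing.Theory Num.Theory.

Local Open Scope classical_set_scope.
Local Open Scope ring_scope.

(** The induced control scales every demand down to the outflow that the
    relaxed solution already uses: [alpha * demand = zbar]
    ([induced_controlK]).  Under this control, the flow that would enter a cell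
    without any FIFO reduction is therefore exactly the relaxed inflow, and the
    relaxed problem bounds it by the supply.  Hence no congestion ever arises:
    the largest admissible FIFO coefficient is [gammaF = 1] in every cell at
    all times ([is_largest_fifo1]), and with [gammaF = 1] the flow equation
    reads [f = R * zbar], which is the routing constraint of the relaxation.
    The mass balance is common to both problems, and the outflow equation
    follows because the routing rows of the cells that are not offramps sum
    to one. *)

Section InducedControl.
Variables (R : realType) (G : network) (K : finType) (N : cdmfn R G K).
Implicit Types (x z : R -> state R G K).

(** The quotient that defines the control cancels where the demand is
    positive; where it vanishes, it forces the outflow it bounds to vanish. *)
Lemma induced_controlK x z t i k :
  0 <= z t i k <= demand N i k (x t i k) ->
  induced_control N x z t i k * demand N i k (x t i k) = z t i k.
Proof.
rewrite /induced_control; have [->|d0] := eqVneq (demand N i k (x t i k)) 0.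
  by move=> z0; rewrite mulr0; apply/eqP; rewrite eq_sym eq_le andbC.
by rewrite andbF divfK.
Qed.

Lemma induced_control_itv x z t i k :
  0 <= z t i k <= demand N i k (x t i k) ->
  0 <= induced_control N x z t i k <= 1.
Proof.
move=> /andP[z0 zd]; rewrite /induced_control.
case: ifPn => [_|nzd]; first by rewrite ler01 lexx.
have d_gt0 : 0 < demand N i k (x t i k).
  rewrite lt_neqAle (le_trans z0 zd) andbT eq_sym.
  apply: contra nzd => /eqP d0; rewrite d0 eqxx andbT eq_le z0 andbT.
  by rewrite -d0.
by rewrite divr_ge0 ?(ltW d_gt0)//= ler_pdivrMr// mul1r.
Qed.

End InducedControl.

(** If the unreduced flow into every cell respects its supply, the FIFO rule
    does not reduce anything, [1] being the top of the allowed range. *)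
Lemma is_largest_fifo1 (R : realType) (G : network) (K : finType)
    (N : cdmfn R G K) (t : R) (a x : state R G K) (i : cell G) :
  (forall j, \sum_k \sum_h routing N t k h j * a h k * demand N h k (x h k)
     <= supply_at N x j) ->
  is_largest (fifo_admissible N t a x i) 1.
Proof.
move=> le_supply; split; last by move=> g [/andP[]].
by split=> [|j _]; [rewrite ler01 lexx | rewrite mul1r].
Qed.

Theorem theorem1 (R : realType) (G : network) (K : finType) (N : cdmfn R G K)
    (phi : cost R G K) (hphi : cost_function phi)
    (T : R) (hT : 0 < T) (x0 : state R G K) (hx0 : nonneg_state x0)
    (xbar zbar : R -> state R G K) (fbar : R -> flow R G K)
    (hbar : feasible (relaxed_problem N phi T x0) (xbar, zbar, fbar)) :
  let alpha := induced_control N xbar zbar in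
  cdmfn_equations N T alpha xbar zbar fbar /\
  feasible (original_problem N phi T x0) (alpha, xbar, zbar, fbar).
Proof.
move=> alpha; case: hbar => sign_constr dyn_constr x_init.
have z_itv t i k : 0 <= t <= T -> 0 <= zbar t i k <= demand N i k (xbar t i k).
  move=> tT; have [_ z0 _ _] := sign_constr t tT.
  by have [_ zd _ _] := dyn_constr t tT i k; rewrite z0 zd.
(* Off the adjacent pairs both sides vanish. *)
have fE t i j k : 0 <= t <= T -> fbar t i j k = routing N t k i j * zbar t i k.
  move=> tT; have [_ _ _ f0] := sign_constr t tT.
  have [_ _ _ f_adj] := dyn_constr t tT i k.
  have [/f_adj//|nadj] := boolP (adjacent_cells i j).
  by rewrite f0// routing_adj ?mul0r//; case/andP: tT.
have fifo_flowE t i j k : 0 <= t <= T ->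
    routing N t k i j * alpha t i k * demand N i k (xbar t i k) = fbar t i j k.
  by move=> tT; rewrite -mulrA induced_controlK ?fE// z_itv.
have eqns : cdmfn_equations N T alpha xbar zbar fbar.
  exists (fun _ _ => 1) => t tT; have t0 : 0 <= t by case/andP: tT.
  split=> [|i k|i k|i j k|i].
  - by have [] := sign_constr t tT.
  - by have [] := dyn_constr t tT i k.
  - case: ifPn => [_|iS]; first by rewrite induced_controlK// z_itv.
    under eq_bigr do rewrite fE//.
    by rewrite -mulr_suml routing_sum// (negbTE iS) mul1r.
  - by rewrite mul1r fifo_flowE.
  - apply: is_largest_fifo1 => j.
    under eq_bigr do under eq_bigr do rewrite fifo_flowE//.
    (* The supply constraint is stated once per commodity, so one commodity is
       needed to obtain it; without any, the total flow is an empty sum. *)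
    have [k _|K0] := pickP (mem K); first by have [] := dyn_constr t tT j k.
    rewrite big_pred0 => [|k]; last by have := K0 k.
    apply: (supply_ge0 (supplyP N j)).
    by rewrite big_pred0 => [|k]; last by have := K0 k.
split=> //; split=> // t i k tT.
exact/induced_control_itv/z_itv.
Qed.
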